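(* Let $G=(V,\mathcal{A})$ be a finite strongly connected directed graph, $\boldsymbol{c}\in\mathbb{R}_+^{|\mathcal{A}|}$ a cost vector, $\boldsymbol{\rho}^0,\boldsymbol{\rho}^\infty\in\mathbb{R}_+^{|V|}$ with $\sum_{i\in V}\rho_i^0=\sum_{i\in V}\rho_i^\infty=1$, and $\boldsymbol{\rho}=\boldsymbol{\rho}^0-\boldsymbol{\rho}^\infty$. Let $\gamma\ge 0$, $\delta>0$, and suppose the capacity vector $\boldsymbol{\pi}^c\in\mathbb{R}_+^{|\mathcal{A}|}$ is finite. Assume that the minimum-cost flow problem is feasible, i.e. there exists $\boldsymbol{\pi}\in\mathbb{R}_+^{|\mathcal{A}|}$ with $\boldsymbol{0}\le\boldsymbol{\pi}\le\boldsymbol{\pi}^c$ and $\operatorname{div}(\boldsymbol{\pi})_i=\rho_i$ for all $i\in V$. Let $(\boldsymbol{\pi}_k^i,\alpha_k^i,\boldsymbol{s}_k^i)_{k\ge 0}$, $i\in V$, be generated by the distributed ADMM scheme defined in the context. Then the following convergence properties hold: (i) The sequence $\sum_{i\in V}\left(f_i(\boldsymbol{\pi}_k^i)+\frac{\gamma}{2}\|\boldsymbol{\pi}_k^i\|^2\right)$ converges, as $k\to\infty$, to the optimal value $\mathcal{W}_1^\gamma(\boldsymbol{\rho}^0,\boldsymbol{\rho}^\infty)$ of problem $(P_\gamma)$ defined in the context. (ii) If $\gamma=0$, then for each node $i\in V$, any limit point $\boldsymbol{\pi}_*^i$ of the sequence $(\boldsymbol{\pi}_k^i)_{k\ge 0}$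 is a solution (minimizer) of problem $(P_0)$, in the sense that the tuple all of whose components equal $\boldsymbol{\pi}_*^i$ is a minimizer of $(P_0)$. Moreover, all limit points coincide, i.e., $\boldsymbol{\pi}_*^i=\boldsymbol{\pi}_*$ for all $i\in V$. (iii) If $\gamma>0$, the solution set of problem $(P_\gamma)$ reduces to a single element $(\boldsymbol{\pi}_*,\dots,\boldsymbol{\pi}_* )$, and for every $i\in V$ the sequence $(\boldsymbol{\pi}_k^i)_{k\ge 1}$ converges to the unique limit $\boldsymbol{\pi}_*$.
   Context: Notation. For a directed graph $G=(V,\mathcal{A})$ with $\mathcal{A}\subset V\times V$, an arc from $i$ to $j$ is the ordered pair $(i,j)$. For $i\in V$, $N^-(i)=\{j\in V:(j,i)\in\mathcal{A}\}$ and $N^+(i)=\{j\in V:(i,j)\in\mathcal{A}\}$. Vectors in $\mathbb{R}^{|\mathcal{A}|}$ are indexed by arcs, inequalities between vectors are componentwise, and $\|\cdot\|$ is the Euclidean norm. For $\boldsymbol{\pi}\in\mathbb{R}_+^{|\mathcal{A}|}$ and $i\in V$, $$\operatorname{div}(\boldsymbol{\pi})_i=\sum_{j\in N^+(i)}\pi_{ij}-\sum_{j\in N^-(i)}\pi_{ji},\qquad f_i(\boldsymbol{\pi})=\sum_{j\in N^+(i)}c_{ij}\pi_{ij}.$$ Problem $(P_\gamma)$. For $\gamma\ge 0$, each node $i\in V$ holds its own copy $\boldsymbol{\pi}^i\in\mathbb{R}_+^{|\mathcal{A}|}$ of the whole flow vector, and $$\mathcal{W}_1^\gamma(\boldsymbol{\rho}^0,\boldsymbol{\rho}^\infty)=\min\left\{\sum_{i\in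 V}\left(f_i(\boldsymbol{\pi}^i)+\frac{\gamma}{2}\|\boldsymbol{\pi}^i\|^2\right)\right\},$$ where the minimum is over all tuples $(\boldsymbol{\pi}^i)_{i\in V}$ with $\boldsymbol{0}\le\boldsymbol{\pi}^i\le\boldsymbol{\pi}^c$ and $\operatorname{div}(\boldsymbol{\pi}^i)_i=\rho_i$ for all $i\in V$, and $\boldsymbol{\pi}^i=\boldsymbol{\pi}^j$ for all $(i,j)\in\mathcal{A}$. Distributed ADMM scheme. Initialize $\boldsymbol{\pi}_0^i=\boldsymbol{s}_0^i=\boldsymbol{0}\in\mathbb{R}^{|\mathcal{A}|}$ and $\alpha_0^i=0$ for every $i\in V$. For $k=0,1,2,\dots$, every $i\in V$ performs $$\boldsymbol{\pi}_{k+1}^i=\underset{\boldsymbol{0}\le\boldsymbol{\pi}^i\le\boldsymbol{\pi}^c}{\arg\min}\ \Big\{\delta^{-1}f_i(\boldsymbol{\pi}^i)+\frac{\delta^{-1}\gamma}{2}\|\boldsymbol{\pi}^i\|^2+\alpha_k^i\operatorname{div}(\boldsymbol{\pi}^i)_i+\frac12\left|\operatorname{div}(\boldsymbol{\pi}^i)_i-\rho_i\right|^2+(\boldsymbol{s}_k^i)^T\boldsymbol{\pi}^i+\frac12\sum_{j\in N^+(i)\cup N^-(i)}\Big\|\boldsymbol{\pi}^i-\frac{\boldsymbol{\pi}_k^i+\boldsymbol{\pi}_k^j}{2}\Big\|^2\Big\},$$ $$\alpha_{k+1}^i=\alpha_k^i+\operatorname{div}(\boldsymbol{\pi}_{k+1}^i)_i-\rho_i,$$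 $$\boldsymbol{s}_{k+1}^i=\boldsymbol{s}_k^i+\frac12\sum_{j\in N^+(i)\cup N^-(i)}\left(\boldsymbol{\pi}_{k+1}^i-\boldsymbol{\pi}_{k+1}^j\right).$$ *)

(* Defs.v *)
From HB Require Import structures.
From mathcomp Require Import all_boot all_order all_algebra.
From mathcomp Require Import all_classical all_reals all_analysis.
Set Implicit Arguments.
Unset Strict Implicit.
Unset Printing Implicit Defensive.
Import Order.TTheory GRing.Theory Num.Theory.
Import numFieldNormedType.Exports.
Local Open Scope classical_set_scope.
Local Open Scope ring_scope.

Definition is_argmin (R : realType) (T : Type) (D : set T) (F : T -> R) (x : T) :=
  D x /\ forall y, D y -> F x <= F y.

Definition is_minimum (R : realType) (T : Type) (D : set T) (F : T -> R) (w : R) :=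
  exists2 x, is_argmin D F x & F x = w.

Definition dotv (R : realType) (n : nat) (x y : 'rV[R]_n) : R :=
  \sum_(a < n) x 0 a * y 0 a.

(* The library norm on 'rV[R]_n is the sup norm, hence this definition;
   both norms induce the library topology on 'rV[R]_n. *)
Definition enorm (R : realType) (n : nat) (x : 'rV[R]_n) : R :=
  Num.sqrt (dotv x x).

Definition vle (R : realType) (n : nat) (x y : 'rV[R]_n) : Prop :=
  forall a, x 0 a <= y 0 a.

Section Graph.
Variables (R : realType) (V : finType) (A : {set V * V}).

Definition strongly_connected : Prop :=
  forall i j : V, connect [rel x y | (x, y) \in A] i j.

Definition Nout (i : V) : {set V} := [set j | (i, j) \in A]%SET.
Definition Nin (i : V) : {set V} := [set j | (j, i) \in A]%SET.

(* Coordinate a : 'I_#|A| of a flow stands for the arc enum_val a, so that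
   summing over the arcs with tail (resp. head) i amounts to summing over
   the j in Nout i (resp. Nin i). *)
Local Notation flow := 'rV[R]_#|A|.
Definition arc_tail (a : 'I_#|A|) : V := (enum_val a).1.
Definition arc_head (a : 'I_#|A|) : V := (enum_val a).2.

Definition flow_div (p : flow) (i : V) : R :=
  \sum_(a < #|A| | arc_tail a == i) p 0 a - \sum_(a < #|A| | arc_head a == i) p 0 a.

Definition local_cost (c : flow) (i : V) (p : flow) : R :=
  \sum_(a < #|A| | arc_tail a == i) c 0 a * p 0 a.

Definition flow_box (pc : flow) : set flow := [set p | vle 0 p /\ vle p pc].

Definition P_feasible (pc : flow) (rho : V -> R) : set (V -> flow) :=
  [set x | (forall i, flow_box pc (x i) /\ flow_div (x i) i = rho i) /\
           (forall i j, (i, j) \in A -> x i = x j)].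

Definition P_objective (c : flow) (gamma : R) (x : V -> flow) : R :=
  \sum_(i : V) (local_cost c i (x i) + gamma / 2 * enorm (x i) ^+ 2).

Definition P_solution (c pc : flow) (rho : V -> R) (gamma : R) :
    set (V -> flow) :=
  [set x | is_argmin (P_feasible pc rho) (P_objective c gamma) x].

Definition is_W1 (c pc : flow) (gamma : R) (rho0 rhoinf : V -> R) (w : R) :=
  is_minimum (P_feasible pc (fun i => rho0 i - rhoinf i)) (P_objective c gamma) w.

(* pk, alpha and s are the values at step k of the flow copies of all nodes
   and of the two multipliers of node i. *)
Definition admm_objective (c : flow) (rho : V -> R) (gamma delta : R)
    (pk : V -> flow) (alpha : R) (s : flow) (i : V) (p : flow) : R :=
  delta^-1 * local_cost c i p
  + delta^-1 * gamma / 2 * enorm p ^+ 2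
  + alpha * flow_div p i
  + 2^-1 * `|flow_div p i - rho i| ^+ 2
  + dotv s p
  + 2^-1 * \sum_(j in Nout i :|: Nin i)
             enorm (p - 2^-1 *: (pk i + pk j)) ^+ 2.

Definition admm (c pc : flow) (rho : V -> R) (gamma delta : R)
    (p : nat -> V -> flow) (alpha : nat -> V -> R) (s : nat -> V -> flow) :=
  (forall i, [/\ p 0%N i = 0, s 0%N i = 0 & alpha 0%N i = 0]) /\
  forall k i,
    [/\ is_argmin (flow_box pc)
          (admm_objective c rho gamma delta (p k) (alpha k i) (s k i) i)
          (p k.+1 i),
        alpha k.+1 i = alpha k i + flow_div (p k.+1 i) i - rho i
      & s k.+1 i = s k i + 2^-1 *: \sum_(j in Nout i :|: Nin i)
                                     (p k.+1 i - p k.+1 j)].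

End Graph.

(* Main.v *)
Require Import Defs.
From HB Require Import structures.
From mathcomp Require Import all_boot all_order all_algebra.
From mathcomp Require Import ring lra.
From mathcomp Require Import all_classical all_reals all_analysis.
Set Implicit Arguments.
Unset Strict Implicit.
Unset Printing Implicit Defensive.
Import Order.TTheory GRing.Theory Num.Theory.
Import numFieldNormedType.Exports.
Local Open Scope classical_set_scope.
Local Open Scope ring_scope.

(** Stack the copies into one vector x and write the consensus problem as the
    minimisation of Phi, the objective divided by delta, over the product of
    the boxes, under the linear constraints C x = b: node i conserves flow, and
    neighbours i and j agree ((x_i - x_j) / 2 = 0).  Summed over the nodes, the
    optimality conditions of the local subproblems (global_step) say that the
    scheme is a proximal method of multipliers: with the multiplier
    l = (alpha, w / 2), where w_ij accumulates the disagreements of i and j,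
    and with S x = ((x_i + x_j) / 2)_ij,

      Phi y - Phi x' + <l', C y - C x'> + <S x' - S x, S y - S x'> >= 0

    for every y in the boxes, and l' = l + C x' - b.  Hence for each saddle
    point (z, m) of the Lagrangian the quantity |l - m|^2 + |S x - S z|^2
    decreases by at least |l' - l|^2 + |S x' - S x|^2 (lyapunov_decrease).  The
    increments therefore vanish, every limit of the iterates along an
    ultrafilter is again a saddle point, and the quantity centred at that limit
    tends to 0 along the ultrafilter, hence along the whole sequence by
    monotonicity (fejer_convergence).  As x_i = (x_i - x_j) / 2 +
    (x_i + x_j) / 2 for any neighbour j of i, the copies themselves converge,
    for gamma = 0 as well, and strong connectivity makes their limits equal
    (scheme_cvg).  All three claims follow; uniqueness for gamma > 0 is
    strict convexity.

    The decrease needs an exact saddle point, and since capacities may vanish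
    there need not be any interior feasible point.  All constraints being
    affine, the multiplier is obtained from Farkas' lemma applied to the slope
    of the objective at a minimiser (P_saddle_exists). *)

(** * Linear inequalities *)

(** Forms are indexed by a sequence so that one can induct on their number, on
    an arbitrary vector space.  If b is not already nonnegative on the cone cut
    out by the tail r, some d0 in that cone has b d0 < 0, hence a i0 d0 < 0;
    projecting along d0 onto the kernel of a i0 reduces to the tail, and the
    coefficient of a i0 is what undoes the projection. *)
Lemma farkas_seq (R : realType) (E : lmodType R) (I : eqType) (r : seq I)
    (a : I -> E -> R) (b : E -> R) :
    uniq r -> (forall i, scalar (a i)) -> scalar b ->
    (forall d, (forall i, i \in r -> 0 <= a i d) -> 0 <= b d) ->
  exists2 m : I -> R, (forall i, 0 <= m i) &
    forall d, b d = \sum_(i <- r) m i * a i d.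
Proof.
elim: r a b => [|i0 r IH] a b /=.
  move=> _ _ lin_b b_ge0; exists (fun=> 0) => // d; rewrite big_nil.
  have bN : b (- d) = - b d.
    have b0 : b 0 = 0.
      have := lin_b 1 0 0; rewrite scale1r mul1r addr0 => /esym/eqP.
      by rewrite -subr_eq0 addrK => /eqP.
    by have := lin_b (-1) d 0; rewrite b0 !addr0 scaleN1r mulN1r.
  apply: le_anti; rewrite b_ge0 // andbT -oppr_ge0 -bN b_ge0 //.
case/andP=> i0r uniq_r lin_a lin_b b_ge0.
have [bneg|] := pselect (exists2 d, (forall i, i \in r -> 0 <= a i d) & b d < 0);
    last first.
  move=> Nbneg; have [] := IH a b uniq_r lin_a lin_b.
    move=> d ad; rewrite leNgt; apply/negP => bd; apply: Nbneg.
    by exists d.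
  move=> m m_ge0 bE; exists (fun i => if i == i0 then 0 else m i).
    by move=> i; case: ifP.
  move=> d; rewrite big_cons eqxx mul0r add0r bE; apply: eq_big_seq => i ir.
  by case: eqP => // ii0; rewrite -ii0 ir in i0r.
case: bneg => d0 ad0 bd0.
have ai0d0 : a i0 d0 < 0.
  rewrite ltNge; apply/negP => a0; move: bd0; apply/negP; rewrite -leNgt.
  by apply: b_ge0 => i; rewrite inE => /predU1P[->|/ad0].
set t := - (a i0 d0)^-1.
have t_gt0 : 0 < t by rewrite oppr_gt0 invr_lt0.
(* t * a i0 d *: d0 + d is the projection of d on the kernel of a i0. *)
pose proj (f : E -> R) d := f d + t * f d0 * a i0 d.
have projE f d : scalar f -> proj f d = f (t * a i0 d *: d0 + d).
  by move=> lin_f; rewrite lin_f /proj; ring.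
have lin_proj f : scalar f -> scalar (proj f).
  by move=> lin_f k u v; rewrite /proj !(lin_a, lin_f); ring.
have [] := IH (fun i => proj (a i)) (proj b) uniq_r.
- by move=> i; apply: lin_proj.
- exact: lin_proj.
- move=> d projd; rewrite projE //; apply: b_ge0 => i.
  rewrite inE => /predU1P[->|ir]; last by rewrite -projE // projd.
  rewrite lin_a le_eqVlt; apply/orP; left; apply/eqP; rewrite /t.
  by field; rewrite lt_eqF.
move=> m m_ge0 bE.
exists (fun i => if i == i0 then t * (\sum_(i <- r) m i * a i d0 - b d0) else m i).
  move=> i; case: ifP => // _; apply: mulr_ge0; first exact: ltW.
  rewrite subr_ge0 (le_trans (ltW bd0)) // big_seq sumr_ge0 // => j jr.
  by rewrite mulr_ge0 // ad0.
move=> d; rewrite big_cons eqxx.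
rewrite [X in _ = _ + X](_ : _ = \sum_(i <- r) m i * a i d); last first.
  by apply: eq_big_seq => i ir; case: eqP => // ii0; rewrite -ii0 ir in i0r.
have -> : b d = proj b d - t * b d0 * a i0 d by rewrite /proj addrK.
rewrite bE /proj.
under eq_bigr do rewrite mulrDr.
rewrite big_split /=.
have -> : \sum_(i <- r) m i * (t * a i d0 * a i0 d) =
   t * a i0 d * \sum_(i <- r) m i * a i d0.
  by rewrite big_distrr /=; apply: eq_bigr => i _; ring.
ring.
Qed.

(** * Fejer convergence of the proximal method of multipliers *)

Lemma ultra_fmap (T U : Type) (f : T -> U) (F : set_system T) :
  UltraFilter F -> UltraFilter (f @ F).
Proof.
move=> FU; split=> [|G GF FG]; first exact: fmap_proper_filter.
apply/seteqP; split=> // A GA.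
have [//|FnA] := in_ultra_setVsetC (f @^-1` A) FU.
have : G (A `&` ~` A) by apply: filterI => //; exact: FG.
by case/filter_ex => ? [].
Qed.

Lemma cvg_sum_real (R : realType) (T : Type) (F : set_system T) (I : Type)
    (r : seq I) (P : pred I) (f : I -> T -> R) (a : I -> R) :
    Filter F -> (forall i, P i -> f i t @[t --> F] --> a i) ->
  \sum_(i <- r | P i) f i t @[t --> F] --> \sum_(i <- r | P i) a i.
Proof. by move=> FF fa; apply: cvg_big => //; exact: add_continuous. Qed.

Lemma sqr_dominated_cvg0 (R : realType) (F : set_system nat) (u e : nat -> R) :
    Filter F -> (forall k, u k ^+ 2 <= e k) ->
  e k @[k --> F] --> (0 : R) -> u k @[k --> F] --> (0 : R).
Proof.
move=> FF ue /cvgr0Pnorm_lt e0; apply/cvgr0Pnorm_lt => eps eps_gt0.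
have := e0 _ (exprn_gt0 2 eps_gt0); apply: filterS => k.
move=> /(le_lt_trans (ler_norm _)) /(le_lt_trans (ue k)).
rewrite -[u k ^+ 2]real_normK ?num_real // ltr_sqr // nnegrE; last exact: ltW.
Qed.

(** Linearity of C and S and convexity of Phi are encoded in the variational
    inequality x_step and in the existence of a saddle point, so that X can be
    any topological space. *)
Section FejerConvergence.
Variables (R : realType) (X : topologicalType) (J L : finType).
Variables (K : set X) (Phi : X -> R) (C : X -> J -> R) (S : X -> L -> R).
Variables (b : J -> R) (x : nat -> X) (l : nat -> J -> R).

Definition saddle (z : X) (m : J -> R) :=
  [/\ K z, forall j, C z j = b j &
      forall y, K y -> Phi z <= Phi y + \sum_j m j * (C y j - b j)].

Hypothesis x_K : forall k, K (x k.+1).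
Hypothesis l_step : forall k j, l k.+1 j = l k j + (C (x k.+1) j - b j).
Hypothesis x_step : forall k y, K y ->
  0 <= Phi y - Phi (x k.+1) + \sum_j l k.+1 j * (C y j - C (x k.+1) j)
     + \sum_i (S (x k.+1) i - S (x k) i) * (S y i - S (x k.+1) i).

Definition lyapunov z m k : R :=
  \sum_j (l k j - m j) ^+ 2 + \sum_i (S (x k) i - S z i) ^+ 2.

(** Adding x_step at y = z to the saddle inequality at y = x k.+1 cancels Phi
    and leaves inner products of an increment with a distance to (z, m); each
    equals half of (new square + increment square - old square). *)
Lemma lyapunov_decrease z m k : saddle z m ->
  lyapunov z m k.+1 + \sum_j (l k.+1 j - l k j) ^+ 2
    + \sum_i (S (x k.+1) i - S (x k) i) ^+ 2 <= lyapunov z m k.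
Proof.
case=> zK zC zmin; have := x_step k zK; have := zmin _ (x_K k).
rewrite /lyapunov.
set F1 := \sum_j m j * _; set F2 := \sum_j l k.+1 j * _.
set G := \sum_i _ * _; set A1 := \sum_j _; set B1 := \sum_i _ ^+ 2.
set A2 := \sum_j _ ^+ 2; set B2 := \sum_i (_ - S (x k) _) ^+ 2.
set A0 := \sum_j (l k j - _) ^+ 2; set B0 := \sum_i (S (x k) _ - _) ^+ 2.
have EA : A1 + A2 - A0 = - (F1 + F2) *+ 2.
  rewrite /A1 /A2 /A0 /F1 /F2 -!big_split -sumrB -sumrN -sumrMnl /=.
  apply: eq_bigr => j _; rewrite zC l_step; ring.
have EB : B1 + B2 - B0 = - G *+ 2.
  rewrite /B1 /B2 /B0 /G -!big_split -sumrB -sumrN -sumrMnl /=.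
  apply: eq_bigr => j _; ring.
lra.
Qed.

Lemma lyapunov_ge0 z m k : 0 <= lyapunov z m k.
Proof. by apply: addr_ge0; apply: sumr_ge0 => i _; exact: sqr_ge0. Qed.

Lemma lyapunov_noninc z m : saddle z m ->
  {homo lyapunov z m : k n / (k <= n)%N >-> n <= k}.
Proof.
move=> zm; apply/nonincreasing_seqP => k.
apply: le_trans (lyapunov_decrease k zm).
by rewrite -addrA lerDl; apply: addr_ge0; apply: sumr_ge0 => i _; exact: sqr_ge0.
Qed.

Lemma sqr_le_sum (I : finType) (u : I -> R) i : u i ^+ 2 <= \sum_j u j ^+ 2.
Proof.
rewrite (bigD1 i) //= lerDl; apply: sumr_ge0 => j _; exact: sqr_ge0.
Qed.

Lemma increments_cvg0 z m : saddle z m ->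
  (forall j, l k.+1 j - l k j @[k --> \oo] --> (0 : R)) /\
  (forall i, S (x k.+1) i - S (x k) i @[k --> \oo] --> (0 : R)).
Proof.
move=> zm; set E := lyapunov z m.
have cvgE : cvgn E.
  apply: nonincreasing_is_cvgn; first exact: lyapunov_noninc.
  by exists 0 => _ [k _ <-]; exact: lyapunov_ge0.
have dE : E k - E k.+1 @[k --> \oo] --> (0 : R).
  rewrite -(subrr (limn E)); apply: cvgB; first exact: cvgE.
  by rewrite (cvg_shiftS E).
have le_dE k : \sum_j (l k.+1 j - l k j) ^+ 2
    + \sum_i (S (x k.+1) i - S (x k) i) ^+ 2 <= E k - E k.+1.
  by rewrite lerBrDl addrA; exact: lyapunov_decrease.
split=> i; apply: sqr_dominated_cvg0 dE => k; apply: le_trans (le_dE k).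
  apply: le_trans (sqr_le_sum (fun j => l k.+1 j - l k j) i) _.
  by rewrite lerDl; apply: sumr_ge0 => j _; exact: sqr_ge0.
apply: le_trans (sqr_le_sum (fun i => S (x k.+1) i - S (x k) i) i) _.
by rewrite lerDr; apply: sumr_ge0 => j _; exact: sqr_ge0.
Qed.

(** An ultrafilter finer than the sequence makes all the bounded quantities
    converge at once, so that no subsequence is extracted. *)
Lemma fejer_convergence :
    compact K -> continuous Phi -> (forall j, continuous (C ^~ j)) ->
    (forall i, continuous (S ^~ i)) -> (exists z m, saddle z m) ->
  exists z m, [/\ saddle z m, forall j, C (x k) j @[k --> \oo] --> C z j &
                 forall i, S (x k) i @[k --> \oo] --> S z i].
Proof.
move=> cptK cPhi cC cS [z0 [m0 zm0]].
have [dl dS] := increments_cvg0 zm0.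
have [U [UU subU]] := @ultraFilterLemma nat \oo _.
have [z [zK xz]] : K `&` [set z | x k.+1 @[k --> U] --> z] !=set0.
  move: cptK; rewrite compact_ultra; apply; first exact: ultra_fmap.
  exact: (@filterE _ U _ (fun k => K (x k.+1))).
have lcvg j : exists mj : R, l k.+1 j @[k --> U] --> mj.
  (* |u| <= 1 + u ^+ 2, and u ^+ 2 is at most the initial Lyapunov value. *)
  set B := 1 + lyapunov z0 m0 0.
  have := @segment_compact R (m0 j - B) (m0 j + B).
  rewrite compact_ultra => /(_ (l k.+1 j @[k --> U]) (ultra_fmap _ UU)) [].
    apply: (@filterE _ U) => k /=; rewrite in_itv /= -ler_distl distrC.
    apply: le_trans (_ : _ <= 1 + (l k.+1 j - m0 j) ^+ 2) _.
      rewrite distrC -(real_normK (num_real _)); nra.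
    rewrite lerD2l; apply: le_trans (lyapunov_noninc zm0 (leq0n k.+1)).
    apply: le_trans (sqr_le_sum (fun j => l k.+1 j - m0 j) j) _.
    by rewrite lerDl; apply: sumr_ge0 => i _; exact: sqr_ge0.
  by move=> mj [_ mjP]; exists mj.
have [m lm] := choice lcvg.
have CU j : C (x k.+1) j @[k --> U] --> C z j.
  exact: (continuous_cvg _ (h := (C ^~ j)) (cC j z) xz).
have SU i : S (x k.+1) i @[k --> U] --> S z i.
  exact: (continuous_cvg _ (h := (S ^~ i)) (cS i z) xz).
have PU : Phi (x k.+1) @[k --> U] --> Phi z.
  exact: (continuous_cvg _ (h := Phi) (cPhi z) xz).
have Cb j : C (x k.+1) j @[k --> \oo] --> b j.
  have -> : b j = b j + 0 by rewrite addr0.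
  under eq_fun do rewrite -[C _ _](subrK (b j)) addrC.
  apply: cvgD; first exact: cvg_cst.
  apply: cvg_trans (dl j); apply: near_eq_cvg; apply: nearW => k.
  by rewrite l_step addrC addKr.
have Cz j : C z j = b j.
  have : C (x k.+1) j @[k --> U] --> b j.
    by apply: cvg_trans (Cb j); exact: cvg_app.
  exact: (cvg_unique _ (CU j)).
have zm : saddle z m.
  split=> // y yK.
  pose T k := Phi y - Phi (x k.+1) + \sum_j l k.+1 j * (C y j - C (x k.+1) j)
     + \sum_i (S (x k.+1) i - S (x k) i) * (S y i - S (x k.+1) i).
  have : T k @[k --> U] --> Phi y - Phi z + \sum_j m j * (C y j - C z j)
     + \sum_i 0 * (S y i - S z i).
    apply: cvgD; first apply: cvgD.
    - by apply: cvgB => //; exact: cvg_cst.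
    - apply: cvg_sum_real => j _; apply: cvgM => //; apply: cvgB => //.
      exact: cvg_cst.
    - apply: cvg_sum_real => i _; apply: cvgM; last first.
        by apply: cvgB => //; exact: cvg_cst.
      by apply: cvg_trans (dS i); exact: cvg_app.
  move=> cvgT; have := cvgr_to_ge cvgT (@filterE _ U _ _ (fun k => x_step k yK)).
  rewrite [X in _ + X]big1 => [|i _]; last by rewrite mul0r.
  under eq_bigr do rewrite Cz.
  by move=> /(_ _ _); rewrite addr0 addrAC subr_ge0; apply.
have E0 : lyapunov z m k.+1 @[k --> U] --> (0 : R).
  have -> : 0 = \sum_j (m j - m j) ^+ 2 + \sum_i (S z i - S z i) ^+ 2.
    by rewrite !big1 ?addr0 // => i _; rewrite subrr expr0n.
  apply: cvgD; apply: cvg_sum_real => i _; rewrite !expr2;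
    by apply: cvgM; apply: cvgB => //; exact: cvg_cst.
(* Smallness along the ultrafilter provides one small value, which
   monotonicity propagates to all later ones. *)
have E_cvg0 : lyapunov z m k @[k --> \oo] --> (0 : R).
  apply/cvgr0Pnorm_lt => eps eps_gt0.
  move/cvgr0Pnorm_lt : E0 => /(_ _ eps_gt0)/filter_ex[k Ek].
  exists k.+1 => // n /= kn; apply: le_lt_trans Ek.
  by rewrite !ger0_norm; [exact: (lyapunov_noninc zm)| |]; exact: lyapunov_ge0.
exists z, m; split=> //.
- by move=> j; rewrite Cz -(cvg_shiftS (fun k => C (x k) j)); exact: Cb.
- move=> i; apply: cvg_sub0; last exact: cvg_cst.
  apply: sqr_dominated_cvg0 E_cvg0 => k.
  apply: le_trans (sqr_le_sum (fun i => S (x k) i - S z i) i) _.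
  by rewrite lerDr; apply: sumr_ge0 => j _; exact: sqr_ge0.
Qed.

End FejerConvergence.

(** * Euclidean product and quadratics along a line *)

Section Dotv.
Variables (R : realType) (n : nat).
Implicit Types x y z : 'rV[R]_n.

Lemma dotvC x y : dotv x y = dotv y x.
Proof. by apply: eq_bigr => a _; rewrite mulrC. Qed.

Lemma dotvDl x y z : dotv (x + y) z = dotv x z + dotv y z.
Proof. by rewrite -big_split; apply: eq_bigr => a _; rewrite !mxE mulrDl. Qed.

Lemma dotvZl k x z : dotv (k *: x) z = k * dotv x z.
Proof. by rewrite /dotv mulr_sumr; apply: eq_bigr => a _; rewrite !mxE mulrA. Qed.

Lemma dotvDr x y z : dotv z (x + y) = dotv z x + dotv z y.
Proof. by rewrite !(dotvC z) dotvDl. Qed.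

Lemma dotvZr k x z : dotv z (k *: x) = k * dotv z x.
Proof. by rewrite !(dotvC z) dotvZl. Qed.

Lemma dotvNl x z : dotv (- x) z = - dotv x z.
Proof. by rewrite -scaleN1r dotvZl mulN1r. Qed.

Lemma dotv_suml (I : finType) (P : pred I) (f : I -> 'rV[R]_n) z :
  dotv (\sum_(i | P i) f i) z = \sum_(i | P i) dotv (f i) z.
Proof.
elim/big_rec2: _ => [|i u v _ <-]; last by rewrite dotvDl.
by rewrite /dotv big1 // => a _; rewrite mxE mul0r.
Qed.

Lemma dotv_ge0 x : 0 <= dotv x x.
Proof. by apply: sumr_ge0 => a _; rewrite -expr2 sqr_ge0. Qed.

Lemma dotv_eq0 x : dotv x x = 0 -> x = 0.
Proof.
move/psumr_eq0P => x0; apply/rowP => a; rewrite mxE.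
by apply/eqP; rewrite -sqrf_eq0 expr2 x0 // => b _; rewrite -expr2 sqr_ge0.
Qed.

Lemma enorm_sqr x : enorm x ^+ 2 = dotv x x.
Proof. by rewrite sqr_sqrtr // dotv_ge0. Qed.

Lemma enorm_sqr_line x d t :
  enorm (x + t *: d) ^+ 2 = enorm x ^+ 2 + t * (dotv x d *+ 2) + t ^+ 2 * dotv d d.
Proof.
rewrite !enorm_sqr !(dotvDl, dotvDr, dotvZl, dotvZr) (dotvC d x); ring.
Qed.

End Dotv.

(** Divide by t and let t tend to 0.  This is how minimality along a feasible
    direction yields a first-order condition. *)
Lemma slope_ge0 (R : realType) (a q : R) :
  (\forall t \near 0^'+, 0 <= t * a + t ^+ 2 * q) -> 0 <= a.
Proof.
move=> h; have cvga : a + t * q @[t --> 0^'+] --> a + 0 * q.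
  apply: cvgD; first exact: cvg_cst.
  apply: cvgM; last exact: cvg_cst.
  exact: cvg_at_right_filter.
rewrite mul0r addr0 in cvga.
apply: (cvgr_to_ge cvga); near=> t.
have t_gt0 : 0 < t by [].
rewrite -(pmulr_rge0 _ t_gt0) mulrDr mulrA -expr2.
by near: t.
Unshelve. all: by end_near. Qed.

Lemma near_right_ge0 (R : realType) (z d : R) : 0 <= z -> (z = 0 -> 0 <= d) ->
  \forall t \near 0^'+, 0 <= z + t * d.
Proof.
rewrite le_eqVlt => /predU1P[<- /(_ erefl) d_ge0|z_gt0 _].
  by near=> t; rewrite add0r mulr_ge0.
have cvgz : z + t * d @[t --> 0^'+] --> z + 0 * d.
  apply: cvgD; first exact: cvg_cst.
  apply: cvgM; last exact: cvg_cst.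
  exact: cvg_at_right_filter.
rewrite mul0r addr0 in cvgz.
by apply: filterS (cvgr_gt _ cvgz _ z_gt0) => t /ltW.
Unshelve. all: by end_near. Qed.

(** * The consensus constraints *)

Section Flows.
Variables (R : realType) (V : finType) (A : {set V * V}).
Notation flow := 'rV[R]_#|A|.

Definition neighbours i : {set V} := Nout A i :|: Nin A i.

Lemma neighbours_sym i j : (j \in neighbours i) = (i \in neighbours j).
Proof. by rewrite !inE orbC. Qed.

Lemma sum_neighbours_swap (F : V -> V -> R) :
  \sum_i \sum_(j in neighbours i) F i j = \sum_i \sum_(j in neighbours i) F j i.
Proof.
rewrite (exchange_big_dep predT) //=; apply: eq_bigr => j _.
by apply: eq_bigl => i; rewrite neighbours_sym.
Qed.

Lemma flow_div_line (x d : flow) t i :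
  flow_div (x + t *: d) i = flow_div x i + t * flow_div d i.
Proof.
rewrite /flow_div mulrBr !mulr_sumr addrACA -opprD -!big_split /=.
by congr (_ - _); apply: eq_bigr => a _; rewrite !mxE.
Qed.

Lemma local_cost_line c (x d : flow) t i :
  local_cost c i (x + t *: d) = local_cost c i x + t * local_cost c i d.
Proof.
rewrite /local_cost mulr_sumr -big_split /=.
by apply: eq_bigr => a _; rewrite !mxE; ring.
Qed.

(** With sg = -1 this is the consensus constraint of the pair e.1, with sg = 1
    the quantity controlled by the proximal term; sharing the formula lets one
    computation treat both.  The coordinates of non-neighbours are 0. *)
Definition edge_mix (sg : R) (x : V -> flow) (e : V * V * 'I_#|A|) : R :=
  if e.1.2 \in neighbours e.1.1
  then 2^-1 * (x e.1.1 0 e.2 + sg * x e.1.2 0 e.2) else 0.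

Definition constraint (x : V -> flow) (j : V + V * V * 'I_#|A|) : R :=
  match j with inl i => flow_div (x i) i | inr e => edge_mix (-1) x e end.

Definition constraint_rhs (rho : V -> R) (j : V + V * V * 'I_#|A|) : R :=
  if j is inl i then rho i else 0.

(** Summation by parts over the ordered pairs of neighbours: swapping i and j
    turns the term at j into the term at i, because G transforms under the swap
    with the same sign as edge_mix. *)
Lemma edge_mix_pairing sg (G : V -> V -> flow) (x y : V -> flow) :
    sg * sg = 1 -> (forall i j, G j i = sg *: G i j) ->
  \sum_(e : V * V * 'I_#|A|)
     (if e.1.2 \in neighbours e.1.1 then 2^-1 * G e.1.1 e.1.2 0 e.2 else 0)
     * (edge_mix sg y e - edge_mix sg x e) =
  \sum_i dotv (2^-1 *: \sum_(j in neighbours i) G i j) (y i - x i).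
Proof.
move=> sg2 Gsym.
transitivity (\sum_i \sum_(j in neighbours i)
    4^-1 * dotv (G i j) (y i - x i + sg *: (y j - x j))).
  rewrite -(pair_bigA _ (fun (ij : V * V) a =>
    (if ij.2 \in neighbours ij.1 then 2^-1 * G ij.1 ij.2 0 a else 0)
     * (edge_mix sg y (ij, a) - edge_mix sg x (ij, a)))) /=.
  rewrite -(pair_bigA _ (fun i j => \sum_(a < #|A|)
    (if j \in neighbours i then 2^-1 * G i j 0 a else 0)
     * (edge_mix sg y (i, j, a) - edge_mix sg x (i, j, a)))) /=.
  apply: eq_bigr => i _; rewrite [RHS]big_mkcond /=; apply: eq_bigr => j _.
  rewrite /edge_mix /=; case: ifP => _; last by rewrite big1 // => a _; ring.
  rewrite /dotv mulr_sumr; by apply: eq_bigr => a _; rewrite !mxE; field.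
rewrite (eq_bigr (fun i => \sum_(j in neighbours i) 4^-1 * dotv (G i j) (y i - x i) +
    \sum_(j in neighbours i) 4^-1 * (sg * dotv (G i j) (y j - x j)))); last first.
  move=> i _; rewrite -big_split /=; apply: eq_bigr => j _.
  by rewrite dotvDr dotvZr mulrDr.
rewrite big_split /= [X in _ + X]sum_neighbours_swap -big_split /=.
apply: eq_bigr => i _; rewrite -big_split dotvZl dotv_suml mulr_sumr /=.
apply: eq_bigr => j _; rewrite (Gsym i j) dotvZl.
have -> : 4^-1 * (sg * (sg * dotv (G i j) (y i - x i))) =
   4^-1 * (sg * sg) * dotv (G i j) (y i - x i) by ring.
by rewrite sg2; field.
Qed.

Lemma constraint_pairing (l : V -> R) (G : V -> V -> flow) (x y : V -> flow) :
    (forall i j, G j i = - G i j) ->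
  \sum_j (match j with
          | inl i => l i
          | inr e => if e.1.2 \in neighbours e.1.1
                     then 2^-1 * G e.1.1 e.1.2 0 e.2 else 0
          end) * (constraint y j - constraint x j) =
  \sum_i l i * (flow_div (y i) i - flow_div (x i) i) +
  \sum_i dotv (2^-1 *: \sum_(j in neighbours i) G i j) (y i - x i).
Proof.
move=> Ganti; rewrite big_sumType /=; congr (_ + _).
by rewrite edge_mix_pairing ?mulrNN ?mulr1 // => i j; rewrite Ganti scaleN1r.
Qed.

End Flows.

(** * Minimisers and saddle points *)

Section Saddle.
Variables (R : realType) (V : finType) (A : {set V * V}).
Variables (c pc : 'rV[R]_#|A|) (gamma delta : R) (rho : V -> R).
Notation flow := 'rV[R]_#|A|.
Notation flows := (prod_topology (fun _ : V => flow)).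

Definition boxes : set flows := [set x | forall i, flow_box pc (x i)].

Definition objective_slope (x d : V -> flow) : R :=
  \sum_i (local_cost c i (d i) + gamma * dotv (x i) (d i)).

Lemma objective_line (x d : V -> flow) t :
  P_objective c gamma (fun i => x i + t *: d i) =
  P_objective c gamma x + t * objective_slope x d +
    t ^+ 2 * (gamma / 2 * \sum_i dotv (d i) (d i)).
Proof.
rewrite /P_objective /objective_slope !mulr_sumr -!big_split /=.
by apply: eq_bigr => i _; rewrite local_cost_line enorm_sqr_line; field.
Qed.

Lemma objective_convex (x y : V -> flow) : 0 <= gamma ->
  objective_slope x (fun i => y i - x i) <= P_objective c gamma y - P_objective c gamma x.
Proof.
move=> gamma_ge0; have := objective_line x (fun i => y i - x i) 1.
under [X in P_objective _ _ X]eq_fun do rewrite scale1r addrC subrK.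
have : 0 <= gamma / 2 * \sum_i dotv (y i - x i) (y i - x i).
  by rewrite mulr_ge0 ?divr_ge0 // sumr_ge0 // => i _; exact: dotv_ge0.
by rewrite mul1r expr1n mul1r; lra.
Qed.

Lemma edge_mix_line sg (x d : V -> flow) t (e : V * V * 'I_#|A|) :
  edge_mix sg (fun i => x i + t *: d i) e = edge_mix sg x e + t * edge_mix sg d e.
Proof. by rewrite /edge_mix; case: ifP => _; rewrite ?mxE; ring. Qed.

Lemma constraint_line (x d : V -> flow) t (j : V + V * V * 'I_#|A|) :
  constraint (fun i => x i + t *: d i) j = constraint x j + t * constraint d j.
Proof. by case: j => [i|e] /=; rewrite ?flow_div_line ?edge_mix_line. Qed.

Lemma scalar_line (f : (V -> flow) -> R) :
    (forall x d t, f (fun i => x i + t *: d i) = f x + t * f d) ->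
  scalar f.
Proof.
move=> fline k u v; rewrite [RHS]addrC -fline; congr f.
by apply/funext => i; rewrite addrC.
Qed.

Lemma coord_cont i a : continuous (fun x : flows => x i 0 a).
Proof.
move=> x; apply: (@continuous_comp _ _ _ (fun x : flows => x i) (fun v : flow => v 0 a)).
  exact: (@proj_continuous _ (fun _ : V => flow) i).
exact: coord_continuous.
Qed.

Lemma flow_div_cvg (T : Type) (F : set_system T) (u : T -> flow) (l : flow) i :
    Filter F -> (forall a, u t 0 a @[t --> F] --> l 0 a) ->
  flow_div (u t) i @[t --> F] --> flow_div l i.
Proof. by move=> FF ul; apply: cvgB; apply: cvg_sum_real. Qed.

Lemma objective_cvg (T : Type) (F : set_system T) (u : T -> V -> flow) (l : V -> flow) :
    Filter F -> (forall i a, u t i 0 a @[t --> F] --> l i 0 a) ->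
  P_objective c gamma (u t) @[t --> F] --> P_objective c gamma l.
Proof.
move=> FF ul; apply: cvg_sum_real => i _; apply: cvgD.
  by apply: cvg_sum_real => a _; apply: cvgM => //; exact: cvg_cst.
under eq_fun do rewrite enorm_sqr; rewrite enorm_sqr.
apply: cvgM; first exact: cvg_cst.
by apply: cvg_sum_real => a _; exact: cvgM.
Qed.

Lemma objective_cont : continuous (P_objective c gamma : flows -> R).
Proof. move=> x; apply: (@objective_cvg _ (nbhs x) id x) => i a; exact: coord_cont. Qed.

Lemma edge_mix_cvg (T : Type) (F : set_system T) (u : T -> V -> flow) (l : V -> flow)
    sg (e : V * V * 'I_#|A|) :
    Filter F -> (forall i a, u t i 0 a @[t --> F] --> l i 0 a) ->
  edge_mix sg (u t) e @[t --> F] --> edge_mix sg l e.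
Proof.
move=> FF ul; rewrite /edge_mix; case: (e.1.2 \in _); last exact: cvg_cst.
apply: cvgM; first exact: cvg_cst.
by apply: cvgD => //; apply: cvgM => //; exact: cvg_cst.
Qed.

Lemma edge_mix_cont sg (e : V * V * 'I_#|A|) :
  continuous (fun x : flows => edge_mix sg x e).
Proof.
move=> x; apply: (@edge_mix_cvg _ (nbhs x) id x) => i a; exact: coord_cont.
Qed.

Lemma constraint_cont (j : V + V * V * 'I_#|A|) :
  continuous (fun x : flows => constraint x j).
Proof.
case: j => [i|e] /=; last exact: edge_mix_cont.
by move=> x; apply: (@flow_div_cvg _ (nbhs x) (@^~ i)) => a; exact: coord_cont.
Qed.

Lemma compact_boxes : compact boxes.
Proof.
apply: (@tychonoff _ (fun _ : V => flow) (fun _ => flow_box pc)) => _.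
have -> : flow_box pc = [set v | forall a, `[0, pc 0 a]%classic (v ord0 a)].
  apply/seteqP; split=> [v [v_ge0 v_le] a|v vbox].
    rewrite /= in_itv /= (le_trans _ (v_ge0 a)) ?mxE //; exact: v_le.
  split=> a; have := vbox a; rewrite /= in_itv /= => /andP[] //.
  by rewrite mxE.
by apply: (@rV_compact R _ (fun a => `[0, pc 0 a]%classic)) => a; exact: segment_compact.
Qed.

Lemma edge_constraint_eq0 (x : V -> flow) i j :
    (forall e, edge_mix (-1) x e = 0) -> j \in neighbours A i -> x i = x j.
Proof.
move=> x0 ij; apply/rowP => a; have := x0 (i, j, a).
rewrite /edge_mix /= ij mulN1r => /eqP.
by rewrite mulf_eq0 invr_eq0 pnatr_eq0 /= subr_eq0 => /eqP.
Qed.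

Lemma P_feasibleE (x : V -> flow) : P_feasible pc rho x <->
  boxes x /\ forall j, constraint x j = constraint_rhs rho j.
Proof.
split=> [[xbox xarc]|[xbox xC]].
  split=> [i|[i|[[i j] a]]] /=; [by case: (xbox i)|by case: (xbox i)|].
  rewrite /edge_mix /=; case: ifP => //; rewrite !inE => /orP[] /xarc ->; ring.
split=> [i|i j ij].
  by split; [exact: xbox|exact: (xC (inl i))].
apply: edge_constraint_eq0 => [e|]; first exact: (xC (inr e)).
by rewrite !inE ij.
Qed.

Lemma P_solution_exists : (exists q : flow, flow_box pc q /\ forall i, flow_div q i = rho i) ->
  exists x, P_solution c pc rho gamma x.
Proof.
case=> q [qbox qdiv].
pose F : set flows := boxes `&` \bigcap_j ((fun x : flows => constraint x j) @^-1` [set constraint_rhs rho j]).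
have FE x : F x <-> P_feasible pc rho x.
  rewrite P_feasibleE; split=> -[xbox xC]; split=> // j; [exact: xC|move=> _; exact: xC].
have [|||x xF xmin] := @compact_EVT_min flows R (P_objective c gamma) F.
- by exists (fun=> q); apply/FE; split.
- apply: compact_closedI; first exact: compact_boxes.
  apply: closed_bigI => j _; apply: closed_comp; last exact: closed_eq.
  by move=> x _; exact: constraint_cont.
- by apply: continuous_subspaceT; exact: objective_cont.
exists x; split; first by apply/FE; rewrite inE in xF.
by move=> y /FE Fy; apply: xmin; rewrite inE.
Qed.

(** A direction in the kernel of the constraints that is compatible with the
    active bounds stays feasible for small steps, the graph being finite. *)
Lemma solution_slope_ge0 (x d : V -> flow) :
    P_solution c pc rho gamma x -> (forall j, constraint d j = 0) ->
    (forall i a, x i 0 a = 0 -> 0 <= d i 0 a) ->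
    (forall i a, x i 0 a = pc 0 a -> d i 0 a <= 0) ->
  0 <= objective_slope x d.
Proof.
move=> [/P_feasibleE[xbox xC] xmin] dC dlo dhi.
apply: (@slope_ge0 _ _ (gamma / 2 * \sum_i dotv (d i) (d i))).
have : \forall t \near 0^'+, forall (ia : V * 'I_#|A|),
    0 <= x ia.1 0 ia.2 + t * d ia.1 0 ia.2 /\
    0 <= (pc 0 ia.2 - x ia.1 0 ia.2) + t * - d ia.1 0 ia.2.
  apply: filter_forall => -[i a] /=; have [x_ge0 x_le] := xbox i.
  near=> t; split.
    near: t; apply: near_right_ge0; last exact: dlo.
    by have := x_ge0 a; rewrite mxE.
  near: t; apply: near_right_ge0; first by rewrite subr_ge0 x_le.
  by move=> /eqP; rewrite subr_eq0 oppr_ge0 => /eqP/esym/dhi.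
apply: filterS => t tbox.
rewrite -(lerDl (P_objective c gamma x)) addrA -objective_line.
apply: xmin; apply/P_feasibleE; split=> [i|j].
  split=> a; have [/= lo hi] := tbox (i, a); rewrite !mxE //.
  by rewrite -subr_ge0; rewrite mulrN -addrA -opprD in hi.
by rewrite constraint_line dC mulr0 addr0.
Unshelve. all: by end_near. Qed.

(** By Farkas' lemma the slope at a minimiser x is a combination of the
    constraints plus nonnegative multiples of the bounds active at x.  On
    y - x with y in the boxes the latter are nonnegative, so the former provide
    the multiplier. *)
Lemma P_saddle_exists : 0 <= gamma -> 0 < delta ->
    (exists q : flow, flow_box pc q /\ forall i, flow_div q i = rho i) ->
  exists (z : flows) m, saddle boxes (fun x => delta^-1 * P_objective c gamma x)
    (@constraint R V A) (constraint_rhs rho) z m.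
Proof.
move=> gamma_ge0 delta_gt0 /P_solution_exists[x xsol].
have [/P_feasibleE[xbox xC] _] := xsol.
pose J := (V + V * V * 'I_#|A|)%type; pose B := (V * 'I_#|A|)%type.
(* Both signs of each constraint; inactive bounds contribute the zero form. *)
pose form (k : J + J + (B + B)) (d : V -> flow) : R := match k with
  | inl (inl j) => constraint d j
  | inl (inr j) => - constraint d j
  | inr (inl b) => if x b.1 0 b.2 == 0 then d b.1 0 b.2 else 0
  | inr (inr b) => if x b.1 0 b.2 == pc 0 b.2 then - d b.1 0 b.2 else 0
  end.
have [] := @farkas_seq R (V -> flow) _ (index_enum _) form (objective_slope x)
  (index_enum_uniq _).
- move=> k; apply: scalar_line => u d t.
  by case: k => [[j|j]|[b|b]] /=; rewrite ?constraint_line;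
    try case: ifP => _; rewrite ?mxE; ring.
- apply: scalar_line => u d t; rewrite /objective_slope mulr_sumr -big_split /=.
  by apply: eq_bigr => i _; rewrite local_cost_line dotvDr dotvZr; ring.
- move=> d form_ge0; have {}form_ge0 k : 0 <= form k d by exact: form_ge0 (mem_index_enum k).
  apply: solution_slope_ge0 => //.
  + move=> j; apply: le_anti.
    have := form_ge0 (inl (inl j)); have := form_ge0 (inl (inr j)).
    by rewrite /= oppr_ge0 => -> ->.
  + by move=> i a x0; have := form_ge0 (inr (inl (i, a))); rewrite /= x0 eqxx.
  + by move=> i a xpc; have := form_ge0 (inr (inr (i, a))); rewrite /= xpc eqxx oppr_ge0.
move=> mu mu_ge0 slopeE.
exists x, (fun j => delta^-1 * (mu (inl (inr j)) - mu (inl (inl j)))).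
split=> // y ybox; have := objective_convex x y gamma_ge0.
rewrite slopeE big_sumType /= [X in X + _]big_sumType [X in _ + X]big_sumType /=.
set S1 := \sum_(i : J) _; set S2 := \sum_(i : J) _.
set T1 := \sum_(b : B) _; set T2 := \sum_(b : B) _.
have T1_ge0 : 0 <= T1.
  apply: sumr_ge0 => b _; apply: mulr_ge0 => //; case: eqP => // x0.
  rewrite !mxE x0 subr0; have [/(_ b.2)] := ybox b.1; by rewrite mxE.
have T2_ge0 : 0 <= T2.
  apply: sumr_ge0 => b _; apply: mulr_ge0 => //; case: eqP => // x0.
  rewrite !mxE x0 opprB subr_ge0; by have [_ /(_ b.2)] := ybox b.1.
have -> : \sum_j delta^-1 * (mu (inl (inr j)) - mu (inl (inl j))) *
    (constraint y j - constraint_rhs rho j) = delta^-1 * (- (S1 + S2)).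
  rewrite /S1 /S2 -big_split -sumrN mulr_sumr; apply: eq_bigr => j _ /=.
  have -> : (fun i => y i - x i) = (fun i => y i + (-1) *: x i).
    by apply/funext => i; rewrite scaleN1r.
  by rewrite constraint_line xC; ring.
move=> yx; rewrite -mulrDr ler_pM2l ?invr_gt0 //; lra.
Qed.

End Saddle.

(** * The iteration as a proximal method of multipliers *)

Section Scheme.
Variables (R : realType) (V : finType) (A : {set V * V}).
Variables (c pc : 'rV[R]_#|A|) (gamma delta : R) (rho : V -> R).
Notation flow := 'rV[R]_#|A|.
Notation flows := (prod_topology (fun _ : V => flow)).
Variables (p : nat -> V -> flow) (alpha : nat -> V -> R) (s : nat -> V -> flow).
Hypothesis gamma_ge0 : 0 <= gamma.
Hypothesis delta_gt0 : 0 < delta.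
Hypothesis scheme : admm c pc rho gamma delta p alpha s.
Notation nb := (neighbours A).

(** A multiplier for each pair of neighbours: the nodes store only the sums
    s, but the individual terms are what matches the constraints x_i = x_j. *)
Definition disagreement k i j : flow := \sum_(l < k) (p l.+1 i - p l.+1 j).

Lemma disagreement_anti k i j : disagreement k j i = - disagreement k i j.
Proof. by rewrite -sumrN; apply: eq_bigr => l _; rewrite opprB. Qed.

Lemma s_disagreement k i : s k i = 2^-1 *: \sum_(j in nb i) disagreement k i j.
Proof.
have [init iter] := scheme.
elim: k => [|k IH].
  have [_ -> _] := init i; rewrite big1 ?scaler0 // => j _.
  by rewrite /disagreement big_ord0.
have [_ _ ->] := iter k i; rewrite IH -scalerDr -big_split /=.
by congr (_ *: _); apply: eq_bigr => j _; rewrite /disagreement big_ord_recr.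
Qed.

(** The increment of x_i + x_j, which the averages (p k i + p k j) / 2 in the
    proximal term leave behind once s is updated. *)
Definition drift k i j : flow := (p k.+1 i - p k i) + (p k.+1 j - p k j).

(** The first-order condition of the local subproblem.  The updates of alpha
    and s absorb the derivatives of the penalty and of part of the proximal
    term into the new multipliers; what remains is the drift. *)
Lemma node_step k i (y : flow) : flow_box pc y ->
  0 <= delta^-1 * (local_cost c i y + gamma / 2 * enorm y ^+ 2
                   - (local_cost c i (p k.+1 i) + gamma / 2 * enorm (p k.+1 i) ^+ 2))
     + alpha k.+1 i * (flow_div y i - flow_div (p k.+1 i) i)
     + dotv (s k.+1 i) (y - p k.+1 i)
     + dotv (2^-1 *: \sum_(j in nb i) drift k i j) (y - p k.+1 i).
Proof.
move=> [y_ge0 y_le]; have [[[p_ge0 p_le] pmin] alphaE sk] := scheme.2 k i.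
set p' := p k.+1 i; rewrite -/p' in p_ge0 p_le pmin alphaE sk.
have [d yE] : exists d, y = p' + 1 *: d.
  by exists (y - p'); rewrite scale1r addrC subrK.
have dE : y - p' = d by rewrite yE scale1r addrC addKr.
pose mid j := 2^-1 *: (p k i + p k j).
have divd : flow_div y i - flow_div p' i = flow_div d i.
  by rewrite yE flow_div_line mul1r addrC addKr.
have costd : local_cost c i y - local_cost c i p' = local_cost c i d.
  by rewrite yE local_cost_line mul1r addrC addKr.
have normd : enorm y ^+ 2 - enorm p' ^+ 2 = dotv p' d *+ 2 + dotv d d.
  by rewrite yE enorm_sqr_line !mul1r expr1n mul1r; ring.
(* slope and curv are the coefficients of t and t ^+ 2 in the local objective
   at p' + t *: d. *)
pose slope := delta^-1 * (local_cost c i d + gamma * dotv p' d)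
  + alpha k i * flow_div d i + (flow_div p' i - rho i) * flow_div d i
  + dotv (s k i) d + \sum_(j in nb i) dotv (p' - mid j) d.
pose curv := delta^-1 * gamma / 2 * dotv d d + 2^-1 * flow_div d i ^+ 2
  + 2^-1 * \sum_(j in nb i) dotv d d.
have slope_d : 0 <= slope.
  apply: (@slope_ge0 _ _ curv); near=> t.
  have := pmin (p' + t *: d).
  have -> : admm_objective c rho gamma delta (p k) (alpha k i) (s k i) i (p' + t *: d) =
    admm_objective c rho gamma delta (p k) (alpha k i) (s k i) i p'
      + (t * slope + t ^+ 2 * curv).
    rewrite /admm_objective -/(neighbours A i) !real_normK ?num_real //.
    rewrite local_cost_line enorm_sqr_line flow_div_line dotvDr dotvZr.
    have -> : \sum_(j in nb i) enorm (p' + t *: d - 2^-1 *: (p k i + p k j)) ^+ 2 =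
      \sum_(j in nb i) enorm (p' - mid j) ^+ 2
        + t * (\sum_(j in nb i) dotv (p' - mid j) d) *+ 2
        + t ^+ 2 * \sum_(j in nb i) dotv d d.
      rewrite [t * _]mulr_sumr [t ^+ 2 * _]mulr_sumr -sumrMnl -!big_split /=.
      apply: eq_bigr => j _.
      by rewrite [X in enorm X]addrAC enorm_sqr_line -/(mid j); ring.
    by rewrite /slope /curv -/mid; field; rewrite gt_eqF.
  have t_gt0 : 0 < t by [].
  have t_le1 : t <= 1 by near: t; exact: nbhs_right_le.
  rewrite lerDl; apply; split=> a; rewrite -dE !mxE.
    by have := p_ge0 a; have := y_ge0 a; rewrite !mxE; nra.
  by have := p_le a; have := y_le a; nra.
have sd : dotv (s k i) d + \sum_(j in nb i) dotv (p' - mid j) d =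
    dotv (s k.+1 i) d + dotv (2^-1 *: \sum_(j in nb i) drift k i j) d.
  rewrite sk -/(neighbours A i) !(dotvDl, dotvZl, dotv_suml) -addrA; congr (_ + _).
  rewrite !mulr_sumr -big_split; apply: eq_bigr => j _ /=.
  by rewrite /drift -/p' /mid !(dotvDl, dotvNl, dotvZl); field.
rewrite dE divd alphaE.
have nodeE : local_cost c i y + gamma / 2 * enorm y ^+ 2
    - (local_cost c i p' + gamma / 2 * enorm p' ^+ 2) =
  local_cost c i d + gamma * dotv p' d + gamma / 2 * dotv d d.
  have -> : enorm y ^+ 2 = enorm p' ^+ 2 + (dotv p' d *+ 2 + dotv d d).
    by rewrite -normd addrC subrK.
  by rewrite -costd; field.
rewrite nodeE mulrDr.
have : 0 <= delta^-1 * (gamma / 2 * dotv d d).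
  by rewrite mulr_ge0 ?invr_ge0 ?(ltW delta_gt0) // mulr_ge0 ?dotv_ge0 // divr_ge0.
move: slope_d; rewrite /slope; move: sd.
set u1 := dotv (s k i) d; set u2 := \sum_(j in nb i) _; set u3 := dotv (s _ _) d.
set u4 := dotv _ d; lra.
Unshelve. all: by end_near. Qed.

Definition multiplier k (j : V + V * V * 'I_#|A|) : R :=
  match j with
  | inl i => alpha k i
  | inr e => if e.1.2 \in nb e.1.1 then 2^-1 * disagreement k e.1.1 e.1.2 0 e.2 else 0
  end.

Lemma multiplier_step k j : multiplier k.+1 j =
  multiplier k j + (constraint (p k.+1) j - constraint_rhs rho j).
Proof.
case: j => [i|e] /=; first by have [_ -> _] := scheme.2 k i; rewrite [RHS]addrA.
rewrite /edge_mix; case: (e.1.2 \in _); last by ring.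
by rewrite /disagreement big_ord_recr /= !mxE; ring.
Qed.

Lemma global_step k (y : flows) : boxes pc y ->
  0 <= delta^-1 * P_objective c gamma y - delta^-1 * P_objective c gamma (p k.+1)
     + \sum_j multiplier k.+1 j * (constraint y j - constraint (p k.+1) j)
     + \sum_e (edge_mix 1 (p k.+1) e - edge_mix 1 (p k) e)
              * (edge_mix 1 y e - edge_mix 1 (p k.+1) e).
Proof.
move=> ybox; rewrite constraint_pairing; last exact: disagreement_anti.
rewrite (eq_bigr (fun e : V * V * 'I_#|A| =>
  (if e.1.2 \in nb e.1.1 then 2^-1 * drift k e.1.1 e.1.2 0 e.2 else 0)
  * (edge_mix 1 y e - edge_mix 1 (p k.+1) e))); last first.
  move=> e _; congr (_ * _); rewrite /edge_mix; case: ifP => _; last by rewrite subrr.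
  by rewrite !mxE; ring.
rewrite edge_mix_pairing ?mul1r //; last first.
  by move=> i j; rewrite scale1r /drift addrC.
rewrite -mulrBr -sumrB mulr_sumr addrA -!big_split /=.
apply: sumr_ge0 => i _; rewrite -s_disagreement; exact: node_step.
Qed.

(** * Convergence of the scheme *)

Lemma scheme_cvg : strongly_connected A ->
    (exists q : flow, flow_box pc q /\ forall i, flow_div q i = rho i) ->
  exists2 pstar : flow, P_solution c pc rho gamma (fun=> pstar) &
    forall i a, p k i 0 a @[k --> \oo] --> pstar 0 a.
Proof.
move=> strongA feas.
have [] := @fejer_convergence R flows _ _ (boxes pc)
  (fun x => delta^-1 * P_objective c gamma x) (@constraint R V A)
  (edge_mix 1) (constraint_rhs rho) p multiplier.
- by move=> k i; have [[]] := scheme.2 k i.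
- exact: multiplier_step.
- exact: global_step.
- exact: compact_boxes.
- by move=> x; exact: (cvgM (cvg_cst _) (objective_cont (x := x))).
- exact: constraint_cont.
- exact: edge_mix_cont.
- exact: P_saddle_exists.
move=> z [m [[zbox zC zmin] Ccvg Scvg]].
have znb i j : j \in nb i -> z i = z j.
  by apply: edge_constraint_eq0 => e; exact: (zC (inr e)).
have zE i j : z i = z j.
  have /connectP[w wpath ->] := strongA i j.
  elim: w i wpath => //= h w IH i /andP[ih /IH <-].
  by apply: znb; rewrite !inE ih.
have zsol : P_solution c pc rho gamma z.
  split=> [|y /P_feasibleE[ybox yC]]; first by apply/P_feasibleE.
  have := zmin y ybox; rewrite big1 => [|j _]; last by rewrite yC subrr mulr0.
  by rewrite addr0 ler_pM2l ?invr_gt0.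
(* A strongly connected graph with a node without neighbours has no arc; the
   flows are then zero-dimensional. *)
have has_nb i (a : 'I_#|A|) : exists j, j \in nb i.
  have aA : enum_val a \in A by exact: enum_valP.
  have [ia|ia] := eqVneq i (enum_val a).1.
    by exists (enum_val a).2; rewrite !inE ia -surjective_pairing aA.
  have /connectP[[|h w] /=] := strongA i (enum_val a).1.
    by move=> _ ai; rewrite ai eqxx in ia.
  by move=> /andP[ih _] _; exists h; rewrite !inE ih.
have pz i a : p k i 0 a @[k --> \oo] --> z i 0 a.
  have [j ij] := has_nb i a.
  have split_mix (x : V -> flow) : x i 0 a =
      constraint x (inr (i, j, a)) + edge_mix 1 x (i, j, a).
    by rewrite /= /edge_mix /= ij; field.
  rewrite split_mix; under eq_fun do rewrite split_mix.
  by apply: cvgD; [exact: Ccvg|exact: Scvg].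
have [i0 _|noV] := pickP V.
  exists (z i0); last by move=> i a; rewrite (zE i0 i).
  by have -> : (fun=> z i0) = z by apply/funext => i.
exists 0; last by move=> i; have := noV i.
by have -> : (fun=> 0) = z by apply/funext => i; have := noV i.
Qed.

End Scheme.

(** Along the segment between two solutions the slope is nonnegative, so
    equality of the values forces the quadratic term to vanish. *)
Lemma P_solution_unique (R : realType) (V : finType) (A : {set V * V})
    (c pc : 'rV[R]_#|A|) gamma (rho : V -> R) (x y : V -> 'rV[R]_#|A|) :
    0 < gamma -> P_solution c pc rho gamma x -> P_solution c pc rho gamma y ->
  x = y.
Proof.
move=> gamma_gt0 xsol [yfeas ymin].
have [xfeas xmin] := xsol; pose d i := y i - x i.
have yE : y = (fun i => x i + 1 *: d i).
  by apply/funext => i; rewrite scale1r addrC subrK.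
have /P_feasibleE[xbox xC] := xfeas; have /P_feasibleE[ybox yC] := yfeas.
have slope_d : 0 <= objective_slope c gamma x d.
  apply: (solution_slope_ge0 xsol) => [j|i a xa|i a xa].
  - have := yC j; rewrite yE constraint_line xC mul1r => /eqP.
    by rewrite -subr_eq0 addrAC subrr add0r => /eqP.
  - by rewrite !mxE xa subr0; have [/(_ a)] := ybox i; rewrite mxE.
  - by rewrite !mxE xa subr_le0; have [_ /(_ a)] := ybox i.
have := ymin x xfeas; rewrite yE objective_line mul1r expr1n mul1r => le_yx.
have sum0 : \sum_i dotv (d i) (d i) = 0.
  apply: le_anti; rewrite sumr_ge0 ?andbT => [|i _]; last exact: dotv_ge0.
  rewrite -(pmulr_rle0 _ (divr_gt0 gamma_gt0 (ltr0Sn R 1))); lra.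
apply/funext => i; rewrite scale1r.
have /psumr_eq0P := sum0 => /(_ (fun i _ => dotv_ge0 (d i))) d0.
by rewrite (dotv_eq0 (d0 i isT)) addr0.
Qed.

Lemma row_cvg (R : realType) n (u : nat -> 'rV[R]_n) (l : 'rV[R]_n) :
  (forall a, u k 0 a @[k --> \oo] --> l 0 a) -> u k @[k --> \oo] --> l.
Proof.
move=> ul; apply/cvg_ballP => e e_gt0.
have : \forall k \near \oo, forall a, ball (l 0 a) e (u k 0 a).
  by apply: filter_forall => a; move/cvg_ballP : (ul a); apply.
by apply: filterS => k uk; split=> // i j; rewrite (ord1 i); exact: uk.
Qed.

Theorem mainTheorem1 (R : realType) (V : finType) (A : {set V * V})
  (c pc : 'rV[R]_#|A|) (rho0 rhoinf rho : V -> R) (gamma delta : R)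
  (p : nat -> V -> 'rV[R]_#|A|) (alpha : nat -> V -> R)
  (s : nat -> V -> 'rV[R]_#|A|)
  (strongA : strongly_connected A)
  (c_ge0 : vle 0 c)
  (rho0_ge0 : forall i, 0 <= rho0 i)
  (rhoinf_ge0 : forall i, 0 <= rhoinf i)
  (rho0_sum : \sum_(i : V) rho0 i = 1)
  (rhoinf_sum : \sum_(i : V) rhoinf i = 1)
  (rhoE : forall i, rho i = rho0 i - rhoinf i)
  (gamma_ge0 : 0 <= gamma) (delta_gt0 : 0 < delta)
  (pc_ge0 : vle 0 pc)
  (feasible : exists q : 'rV[R]_#|A|,
     flow_box pc q /\ forall i, flow_div q i = rho i)
  (scheme : admm c pc rho gamma delta p alpha s) :
  [/\ exists2 w : R, is_W1 c pc gamma rho0 rhoinf w &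
        P_objective c gamma (p k) @[k --> \oo] --> w,
      gamma = 0 ->
        (forall (i : V) (l : 'rV[R]_#|A|),
           cluster (p k i @[k --> \oo]) l ->
           P_solution c pc rho 0 (fun=> l)) /\
        (exists pstar : 'rV[R]_#|A|, forall (i : V) (l : 'rV[R]_#|A|),
           cluster (p k i @[k --> \oo]) l -> l = pstar)
    & 0 < gamma ->
        exists2 pstar : 'rV[R]_#|A|,
          P_solution c pc rho gamma = [set (fun=> pstar)] &
          forall i : V, p k i @[k --> \oo] --> pstar].
Proof.
have [pstar psol pcvg] := scheme_cvg gamma_ge0 delta_gt0 scheme strongA feasible.
have p_cvg i : p k i @[k --> \oo] --> pstar by apply: row_cvg => a; exact: pcvg.
have cluster_p i l : cluster (p k i @[k --> \oo]) l -> l = pstar.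
  by move=> /(cvg_cluster (p_cvg i)) /norm_hausdorff.
split.
- exists (P_objective c gamma (fun=> pstar)); last exact: objective_cvg.
  exists (fun=> pstar) => //.
  by have <- : rho = (fun i => rho0 i - rhoinf i) by exact/funext.
- move=> gamma0; split; last by exists pstar.
  by move=> i l /cluster_p ->; rewrite -gamma0.
- move=> gamma_gt0; exists pstar => //.
  apply/seteqP; split=> [x xsol|_ ->] //=.
  exact: (P_solution_unique gamma_gt0 xsol psol).
Qed.
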